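(* Let $\Lambda$ be a solid partition. Let $\mathcal R_\Lambda=\{R(i,j,k)\}$, $\mathcal Q_\Lambda=\{Q(i,j,k)\}$, $\mathcal R^\ast_\Lambda=\{R^\ast(i,j,k)\}$, $\mathcal Q^\ast_\Lambda=\{Q^\ast(i,j,k)\}$ be the multisets of these numbers over all $(i,j,k)\in\Lambda$. Then $\mathcal R_\Lambda$ majorizes $\mathcal R^\ast_\Lambda$, and $\mathcal Q_\Lambda$ majorizes $\mathcal Q^\ast_\Lambda$.
   Context: A solid partition $\Lambda$ is a finite subset of $\mathbb Z_{\ge0}^3$ that is a lower order ideal for the componentwise order: if $(i,j,k)\in\Lambda$ and $p\le i$, $q\le j$, $r\le k$ (with $p,q,r\ge0$), then $(p,q,r)\in\Lambda$. For $(i,j,k)\in\Lambda$ define $R(i,j,k)=\bigl|\{(p,j,k)\in\Lambda:i\le p\}\cup\{(i,q,k)\in\Lambda:j\le q\}\cup\{(i,j,r)\in\Lambda:k\le r\}\bigr|$, $Q(i,j,k)=\bigl|\{(p,q,k)\in\Lambda:i\le p,\ j\le q\}\cup\{(p,j,r)\in\Lambda:i\le p,\ k\le r\}\cup\{(i,q,r)\in\Lambda:j\le q,\ k\le r\}\bigr|$, and the anti-hooks $R^\ast,Q^\ast$ analogously with all inequalities reversed: $R^\ast(i,j,k)=\bigl|\{(p,j,k)\in\Lambda:p\le i\}\cup\{(i,q,k)\in\Lambda:q\le j\}\cup\{(i,j,r)\in\Lambda:r\le k\}\bigr|$, $Q^\ast(i,j,k)=\bigl|\{(p,q,k)\in\Lambda:p\le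 i,\ q\le j\}\cup\{(p,j,r)\in\Lambda:p\le i,\ r\le k\}\cup\{(i,q,r)\in\Lambda:q\le j,\ r\le k\}\bigr|$. Majorization: for two multisets $\mathcal A,\mathcal B$ of $n$ real numbers with elements $a_1\ge\dots\ge a_n$ and $b_1\ge\dots\ge b_n$ in non-increasing order, $\mathcal A$ majorizes $\mathcal B$ if $a_1+\dots+a_k\ge b_1+\dots+b_k$ for all $1\le k<n$ and $a_1+\dots+a_n=b_1+\dots+b_n$. *)

(* Defs.v *)
From mathcomp Require Import all_boot all_order all_algebra.
From mathcomp Require Import finmap multiset.

Set Implicit Arguments.
Unset Strict Implicit.
Unset Printing Implicit Defensive.

Local Open Scope fset_scope.
Local Open Scope mset_scope.

(* The point (i, j, k) is the left-nested pair ((i, j), k), with coordinates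
   c.1.1, c.1.2 and c.2. *)
Definition point := (nat * nat * nat)%type.

Definition solid_partition (L : {fset point}) : Prop :=
  forall i j k p q r : nat,
    (i, j, k) \in L -> p <= i -> q <= j -> r <= k -> (p, q, r) \in L.

Definition hookR (L : {fset point}) (x : point) : nat :=
  let: (i, j, k) := x in
  #|` ([fset c in L | [&& i <= c.1.1, c.1.2 == j & c.2 == k]]
   `|` [fset c in L | [&& c.1.1 == i, j <= c.1.2 & c.2 == k]]
   `|` [fset c in L | [&& c.1.1 == i, c.1.2 == j & k <= c.2]])%fset |.

Definition hookQ (L : {fset point}) (x : point) : nat :=
  let: (i, j, k) := x in
  #|` ([fset c in L | [&& i <= c.1.1, j <= c.1.2 & c.2 == k]]
   `|` [fset c in L | [&& i <= c.1.1, c.1.2 == j & k <= c.2]]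
   `|` [fset c in L | [&& c.1.1 == i, j <= c.1.2 & k <= c.2]])%fset |.

Definition antihookR (L : {fset point}) (x : point) : nat :=
  let: (i, j, k) := x in
  #|` ([fset c in L | [&& c.1.1 <= i, c.1.2 == j & c.2 == k]]
   `|` [fset c in L | [&& c.1.1 == i, c.1.2 <= j & c.2 == k]]
   `|` [fset c in L | [&& c.1.1 == i, c.1.2 == j & c.2 <= k]])%fset |.

Definition antihookQ (L : {fset point}) (x : point) : nat :=
  let: (i, j, k) := x in
  #|` ([fset c in L | [&& c.1.1 <= i, c.1.2 <= j & c.2 == k]]
   `|` [fset c in L | [&& c.1.1 <= i, c.1.2 == j & c.2 <= k]]
   `|` [fset c in L | [&& c.1.1 == i, c.1.2 <= j & c.2 <= k]])%fset |.

Section Majorization.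
Variable T : realFieldType.
Local Open Scope ring_scope.

Definition nonincreasing_seq (A : {mset T}) : seq T := sort >=%R (enum_mset A).

Definition majorizes (A B : {mset T}) : Prop :=
  let a := nonincreasing_seq A in
  let b := nonincreasing_seq B in
  [/\ size a = size b,
      forall k : nat, (1 <= k < size a)%N ->
        \sum_(0 <= i < k) b`_i <= \sum_(0 <= i < k) a`_i
    & \sum_(0 <= i < size a) a`_i = \sum_(0 <= i < size b) b`_i].

Definition value_multiset (L : {fset point}) (f : point -> nat) : {mset T} :=
  seq_mset [seq (f x)%:R | x <- enum_fset L].

End Majorization.

(* Main.v *)
Require Import Defs.
From mathcomp Require Import all_boot all_order all_algebra.
From mathcomp Require Import finmap multiset zify.

Set Implicit Arguments.
Unset Strict Implicit.
Unset Printing Implicit Defensive.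

(* Compress a subset S of L successively along the three coordinate directions:
   within each line, move the chosen cells to the start of the line.  The
   resulting subset S' of L has the cardinality of S, and the antihooks of S sum
   to at most the hooks of S'.  Indeed R* = 1 + i + j + k and
   Q* = R* + ij + ik + jk; compressing along one direction replaces in these
   expressions the corresponding coordinate by the arm in that direction, and
   the product of an arm by a coordinate by the number of cells in an open
   quadrant, without decreasing sums over the chosen set.  The remaining terms
   can only grow because they do not increase along the line.  Taking for S the
   cells with the n largest antihooks gives the partial sum inequalities, while
   the totals agree since y lies in the hook of x iff x lies in the antihook of
   y. *)

(** * Rearrangement inequalities on a single line *)

Lemma sum_indicator_le N (s : nat -> bool) : \sum_(k < N) s k <= N.
Proof.
by rewrite -[leqRHS]card_ord -sum1_card; apply: leq_sum => k _; case: (s k).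
Qed.

Lemma sum_below (n N : nat) (v : nat -> nat) : n <= N ->
  \sum_(k < N) (k < n) * v k = \sum_(k < n) v k.
Proof.
move=> le_nN; rewrite (big_ord_widen _ v le_nN) [RHS]big_mkcond /=.
by apply: eq_bigr => k _; case: (k < n); rewrite ?mul1n ?mul0n.
Qed.

(** Induction on the bound: if [p N] holds, downward closure fills the whole range; otherwise the
    bound drops to [N]. *)
Lemma lower_predE N (p : nat -> bool) :
    (forall k r, p k -> r <= k -> p r) -> (forall k, p k -> k < N) ->
  forall k, p k = (k < \sum_(r < N) p r).
Proof.
move=> p_low; elim: N => [|N IH] pN k.
  by rewrite big_ord0 ltn0; apply/negP => /pN.
rewrite big_ord_recr /=; have [pNN|npN] := boolP (p N).
  have pT (i : 'I_N) : p i by apply: p_low pNN _; exact: ltnW.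
  rewrite (eq_bigr (fun=> 1)) => [|i _]; last by rewrite pT.
  rewrite sum1_card card_ord addn1; apply/idP/idP => [/pN//|].
  by rewrite ltnS; exact: p_low.
rewrite addn0; apply: IH => r pr.
rewrite ltn_neqAle -ltnS pN // andbT.
by apply: contraNneq npN => <-.
Qed.

(** A chosen index is at least the number of indices chosen before it, so moving it down to that
    position cannot decrease [u]. *)
Lemma sum_noninc_le N (s : nat -> bool) (u : nat -> nat) :
    (forall k r, r <= k -> u k <= u r) ->
  \sum_(k < N) s k * u k <= \sum_(k < \sum_(k < N) s k) u k.
Proof.
move=> u_dec; elim: N => [|N IH]; first by rewrite big_ord0.
rewrite !big_ord_recr /=; case: (s N); last by rewrite mul0n !addn0.
rewrite mul1n addn1 big_ord_recr /= leq_add //.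
exact/u_dec/sum_indicator_le.
Qed.

(** The right side adds up the largest indices below [b], as many as are chosen; read from the start
    of the line they are arm lengths. *)
Lemma sum_index_le b (s : nat -> bool) :
  \sum_(k < b) s k * k <= \sum_(k < \sum_(k < b) s k) (b - k.+1).
Proof.
elim: b => [|b IH]; first by rewrite big_ord0.
rewrite !big_ord_recr /=; case: (s b); last first.
  rewrite mul0n !addn0; apply: leq_trans IH _.
  by apply: leq_sum => k _; apply: leq_sub2r.
(* The chosen index [b] equals the first term on the right; the other terms shift by one. *)
rewrite mul1n addn1 big_ord_recl /= subSS subn0 addnC leq_add2l.
apply: leq_trans IH _; apply: leq_sum => k _.
by rewrite /bump /= subSS.
Qed.

(** The right side runs over an initial segment that depends only on the number of chosen indices;
    hence such inequalities can be added and scaled. *)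
Definition line_dom N (p : nat -> bool) (u v : nat -> nat) :=
  forall s : nat -> bool, (forall k, s k -> p k) ->
  \sum_(k < N) s k * u k <= \sum_(k < \sum_(k < N) s k) v k.

Lemma line_domD N p u v u' v' : line_dom N p u v -> line_dom N p u' v' ->
  line_dom N p (fun k => u k + u' k) (fun k => v k + v' k).
Proof.
move=> uv uv' s sp; rewrite big_split /=.
under eq_bigr => k do rewrite mulnDr.
by rewrite big_split leq_add ?uv ?uv'.
Qed.

Lemma line_dom_sum N p M (w : nat -> nat) (u v : nat -> nat -> nat) :
    (forall i, line_dom N p (u i) (v i)) ->
  line_dom N p (fun k => \sum_(i < M) w i * u i k)
               (fun k => \sum_(i < M) w i * v i k).
Proof.
move=> uv s sp; rewrite [leqRHS]exchange_big /=.
under eq_bigr => k do rewrite big_distrr /=.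
rewrite exchange_big /=; apply: leq_sum => i _.
under eq_bigr => k do rewrite mulnCA.
by rewrite -!big_distrr leq_mul2l uv ?orbT.
Qed.

Lemma line_domZ N p w u v : line_dom N p u v ->
  line_dom N p (fun k => w * u k) (fun k => w * v k).
Proof.
move=> uv s sp; under eq_bigr => k do rewrite mulnCA.
by rewrite -!big_distrr leq_mul2l uv ?orbT.
Qed.

Lemma line_dom_noninc N p u : (forall k r, r <= k -> u k <= u r) ->
  line_dom N p u u.
Proof. by move=> u_dec s _; exact: sum_noninc_le. Qed.

Lemma sum_above N b k : b <= N -> \sum_(r < N) (k < r) * (r < b) = b - k.+1.
Proof.
move=> le_bN; under eq_bigr => r _ do rewrite mulnC.
rewrite (sum_below (fun r => nat_of_bool (k < r)) le_bN).
elim: b {le_bN} => [|b IH]; first by rewrite big_ord0.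
rewrite big_ord_recr /= IH; case: ltnP; lia.
Qed.

(** [q] is an initial segment, of length [b] say, and the right side is [b - k.+1], so
    [sum_index_le] applies to the chosen indices below [b]. Those outside [q] contribute zero on the
    left and only lengthen the segment on the right. *)
Lemma line_dom_flip N p (q : nat -> bool) :
    (forall k r, q k -> r <= k -> q r) -> (forall k, q k -> k < N) ->
  line_dom N p (fun k => q k * k) (fun k => \sum_(r < N) (k < r) * q r).
Proof.
move=> q_low qN s _; have qE := lower_predE q_low qN.
set b := \sum_(r < N) q r in qE; have le_bN : b <= N by exact: sum_indicator_le.
have vE k : \sum_(r < N) (k < r) * q r = b - k.+1.
  by rewrite -(sum_above k le_bN); apply: eq_bigr => r _; rewrite qE.
under [leqRHS]eq_bigr => k do rewrite vE.
have -> : \sum_(k < N) s k * (q k * k) = \sum_(k < b) s k * k.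
  rewrite -(sum_below (fun k => s k * k) le_bN).
  by apply: eq_bigr => k _; rewrite qE mulnCA.
apply: leq_trans (sum_index_le _ _) _.
have le_n : \sum_(k < b) s k <= \sum_(k < N) s k.
  rewrite -(sum_below (fun k => nat_of_bool (s k)) le_bN).
  by apply: leq_sum => k _; case: (k < b); rewrite ?mul1n.
rewrite (big_ord_widen _ (fun k => b - k.+1) le_n) [leqLHS]big_mkcond.
by apply: leq_sum => k _; case: ifP.
Qed.

Lemma line_dom_flip_self N (p : nat -> bool) :
    (forall k r, p k -> r <= k -> p r) -> (forall k, p k -> k < N) ->
  line_dom N p id (fun k => \sum_(r < N) (k < r) * p r).
Proof.
(* Chosen indices satisfy [p], so the factor [p k] can be inserted. *)
move=> p_low pN s sp; rewrite (eq_bigr (fun k : 'I_N => s k * (p k * k))).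
  exact: line_dom_flip p_low pN s sp.
by move=> k _ /=; case sk: (s k); rewrite ?(sp _ sk) ?mul1n.
Qed.

(** * Compression of selections in a box along coordinate lines *)

Definition boxsum N (f : nat -> nat -> nat -> nat) :=
  \sum_(i < N) \sum_(j < N) \sum_(k < N) f i j k.

(** The new selection is existentially quantified, so dominations along different directions
    compose. *)
Definition box_dom N (l : nat -> nat -> nat -> bool)
    (u v : nat -> nat -> nat -> nat) :=
  forall s : nat -> nat -> nat -> bool, (forall i j k, s i j k -> l i j k) ->
  exists s' : nat -> nat -> nat -> bool,
    [/\ forall i j k, s' i j k -> l i j k,
        boxsum N (fun i j k => s' i j k) = boxsum N (fun i j k => s i j k)
      & boxsum N (fun i j k => s i j k * u i j k) <=
        boxsum N (fun i j k => s' i j k * v i j k)].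

Lemma box_dom_trans N l u v w :
  box_dom N l u v -> box_dom N l v w -> box_dom N l u w.
Proof.
move=> uv vw s sl; have [s1 [s1l c1 le1]] := uv s sl.
have [s2 [s2l c2 le2]] := vw s1 s1l.
by exists s2; split; rewrite ?c2 //; exact: leq_trans le2.
Qed.

Lemma boxsum_swap23 N f : boxsum N f = boxsum N (fun i k j => f i j k).
Proof. by apply: eq_bigr => i _; rewrite exchange_big. Qed.

Lemma boxsum_swap12 N f : boxsum N f = boxsum N (fun j i k => f i j k).
Proof. by rewrite /boxsum exchange_big. Qed.

Lemma box_dom_swap23 N l u v :
    box_dom N (fun i k j => l i j k) (fun i k j => u i j k)
              (fun i k j => v i j k) ->
  box_dom N l u v.
Proof.
move=> uv s sl; have [|s' [s'l c le]] := uv (fun i k j => s i j k).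
  by move=> i k j; exact: sl.
exists (fun i j k => s' i k j); split=> [i j k|//|]; first exact: s'l.
  by rewrite boxsum_swap23 c -boxsum_swap23.
by rewrite boxsum_swap23 [leqRHS]boxsum_swap23.
Qed.

Lemma box_dom_swap12 N l u v :
    box_dom N (fun j i k => l i j k) (fun j i k => u i j k)
              (fun j i k => v i j k) ->
  box_dom N l u v.
Proof.
move=> uv s sl; have [|s' [s'l c le]] := uv (fun j i k => s i j k).
  by move=> j i k; exact: sl.
exists (fun i j k => s' j i k); split=> [i j k|//|]; first exact: s'l.
  by rewrite boxsum_swap12 c -boxsum_swap12.
by rewrite boxsum_swap12 [leqRHS]boxsum_swap12.
Qed.

Section LowerBox.
Variables (N : nat) (l : nat -> nat -> nat -> bool).
Hypothesis l_low : forall i j k p q r,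
  l i j k -> p <= i -> q <= j -> r <= k -> l p q r.
Hypothesis l_bound : forall i j k, l i j k -> [/\ i < N, j < N & k < N].

Lemma box_dom_lines3 u v :
  (forall i j, line_dom N (l i j) (u i j) (v i j)) -> box_dom N l u v.
Proof.
move=> uv s sl; pose n i j := \sum_(k < N) s i j k.
have nN i j : n i j <= N by exact: sum_indicator_le.
have low i j k r : l i j k -> r <= k -> l i j r.
  by move=> lk le_rk; apply: l_low lk _ _ le_rk.
have bnd i j k : l i j k -> k < N by case/l_bound.
(* Each line keeps its number of chosen cells, moved to the start; they stay in [l], whose line is
   an initial segment at least as long. *)
exists (fun i j k => k < n i j); split.
- move=> i j k lt_kn; rewrite (lower_predE (low i j) (bnd i j)).
  apply: leq_trans lt_kn _; apply: leq_sum => r _.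
  by case sr: (s i j r); rewrite ?(sl _ _ _ sr).
- apply: eq_bigr => i _; apply: eq_bigr => j _.
  under eq_bigr => k _ do rewrite -[nat_of_bool _]muln1.
  by rewrite (sum_below (fun=> 1) (nN i j)) sum1_card card_ord.
apply: leq_sum => i _; apply: leq_sum => j _.
by rewrite (sum_below _ (nN i j)); apply: uv => k; exact: sl.
Qed.
End LowerBox.

Section Steps.
Variables (N : nat) (l : nat -> nat -> nat -> bool).
Hypothesis l_low : forall i j k p q r,
  l i j k -> p <= i -> q <= j -> r <= k -> l p q r.
Hypothesis l_bound : forall i j k, l i j k -> [/\ i < N, j < N & k < N].

Lemma box_dom_lines2 u v :
    (forall i k, line_dom N (fun j => l i j k) (fun j => u i j k)
                            (fun j => v i j k)) ->
  box_dom N l u v.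
Proof.
move=> uv; apply/box_dom_swap23/box_dom_lines3; last by [].
- by move=> i k j p r q lijk *; apply: l_low lijk _ _ _.
- by move=> i k j /l_bound[].
Qed.

(** Two swaps carry the first coordinate to the last place. *)
Lemma box_dom_lines1 u v :
    (forall j k, line_dom N (fun i => l i j k) (fun i => u i j k)
                            (fun i => v i j k)) ->
  box_dom N l u v.
Proof.
move=> uv; apply/box_dom_swap12/box_dom_swap23/box_dom_lines3; last by [].
- by move=> j k i q r p lijk *; apply: l_low lijk _ _ _.
- by move=> j k i /l_bound[].
Qed.

(** * Arms, faces and the compression of the hook formulas *)

Definition arm1 i j k := \sum_(p < N) (i < p) * l p j k.
Definition arm2 i j k := \sum_(q < N) (j < q) * l i q k.
Definition arm3 i j k := \sum_(r < N) (k < r) * l i j r.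
(** An open quadrant is grouped into arms of the direction compressed later, so that the flip of
    that direction applies arm by arm. *)
Definition face12 i j k := \sum_(p < N) (i < p) * arm2 p j k.
Definition face13 i j k := \sum_(p < N) (i < p) * arm3 p j k.
Definition face23 i j k := \sum_(q < N) (j < q) * arm3 i q k.

(** Moving a line towards the origin keeps its cells, since [l] is a lower set. *)
Lemma arm1_noninc i j k q r : q <= j -> r <= k -> arm1 i j k <= arm1 i q r.
Proof.
move=> qj rk; apply: leq_sum => p _; apply: leq_mul => //.
by have [lp|//] := boolP (l p j k); rewrite (l_low lp (leqnn _) qj rk).
Qed.

Lemma arm2_noninc i j k p r : p <= i -> r <= k -> arm2 i j k <= arm2 p j r.
Proof.
move=> pi rk; apply: leq_sum => q _; apply: leq_mul => //.
by have [lp|//] := boolP (l i q k); rewrite (l_low lp pi (leqnn _) rk).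
Qed.

Lemma face12_noninc i j k r : r <= k -> face12 i j k <= face12 i j r.
Proof.
by move=> rk; apply: leq_sum => p _; rewrite leq_mul2l arm2_noninc ?orbT.
Qed.

Lemma line1_flip j k : line_dom N (fun i => l i j k) id (fun i => arm1 i j k).
Proof.
apply: line_dom_flip_self => [i p lp le|i /l_bound[]//].
exact: l_low lp le _ _.
Qed.

(** [p] is arbitrary because [line2_flip_face12] flips lines parallel to the one carrying the
    selection, and these may not contain it. *)
Lemma line2_flip p i k :
  line_dom N p (fun j => l i j k * j) (fun j => arm2 i j k).
Proof.
apply: line_dom_flip => [j q lp le|j /l_bound[]//].
exact: l_low lp _ le _.
Qed.

Lemma line2_flip_self i k :
  line_dom N (fun j => l i j k) id (fun j => arm2 i j k).
Proof.
apply: line_dom_flip_self => [j q lp le|j /l_bound[]//].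
exact: l_low lp _ le _.
Qed.

Lemma line3_flip p i j :
  line_dom N p (fun k => l i j k * k) (fun k => arm3 i j k).
Proof.
apply: line_dom_flip => [k r lp le|k /l_bound[]//].
exact: l_low lp _ _ le.
Qed.

Lemma line3_flip_self i j : line_dom N (l i j) id (arm3 i j).
Proof.
apply: line_dom_flip_self => [k r lp le|k /l_bound[]//].
exact: l_low lp _ _ le.
Qed.

(* An arm is a sum of indicators of parallel lines, each handled by the flip
   above. *)
Lemma line2_flip_face12 p i k :
  line_dom N p (fun j => arm1 i j k * j) (fun j => face12 i j k).
Proof.
have fE j : arm1 i j k * j = \sum_(p < N) (i < p) * (l p j k * j).
  by rewrite big_distrl; apply: eq_bigr => ? _; rewrite mulnA.
move=> s sp; under eq_bigr => j do rewrite fE.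
apply: (@line_dom_sum N _ N (fun p => nat_of_bool (i < p))
  (fun p j => l p j k * j) (fun p j => arm2 p j k) _ s sp) => q.
exact: line2_flip.
Qed.

Lemma line3_flip_face13 p i j :
  line_dom N p (fun k => arm1 i j k * k) (fun k => face13 i j k).
Proof.
have fE k : arm1 i j k * k = \sum_(p < N) (i < p) * (l p j k * k).
  by rewrite big_distrl; apply: eq_bigr => ? _; rewrite mulnA.
move=> s sp; under eq_bigr => k do rewrite fE.
apply: (@line_dom_sum N _ N (fun p => nat_of_bool (i < p))
  (fun p k => l p j k * k) (fun p k => arm3 p j k) _ s sp) => q.
exact: line3_flip.
Qed.

Lemma line3_flip_face23 p i j :
  line_dom N p (fun k => arm2 i j k * k) (fun k => face23 i j k).
Proof.
have fE k : arm2 i j k * k = \sum_(q < N) (j < q) * (l i q k * k).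
  by rewrite big_distrl; apply: eq_bigr => ? _; rewrite mulnA.
move=> s sp; under eq_bigr => k do rewrite fE.
apply: (@line_dom_sum N _ N (fun q => nat_of_bool (j < q))
  (fun q k => l i q k * k) (fun q k => arm3 i q k) _ s sp) => q.
exact: line3_flip.
Qed.

Lemma line_dom_cst p c : line_dom N p (fun=> c) (fun=> c).
Proof. exact: line_dom_noninc. Qed.

(* The antihook formulas after compression along the first direction (flip1)
   and along the first two (flip2). *)
Definition flip1R i j k := 1 + (arm1 i j k + j + k).
Definition flip2R i j k := 1 + (arm1 i j k + arm2 i j k + k).
Definition flip1Q i j k :=
  flip1R i j k + (j * arm1 i j k + k * arm1 i j k + j * k).
Definition flip2Q i j k :=
  flip2R i j k + (face12 i j k + k * arm1 i j k + k * arm2 i j k).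

Lemma line1_R j k : line_dom N (fun i => l i j k)
  (fun i => 1 + (i + j + k)) (fun i => flip1R i j k).
Proof.
by do !apply: line_domD; try exact: line_dom_cst; exact: line1_flip.
Qed.

(** Along the line [arm1] does not increase, [j] flips to [arm2], and [k] is constant. *)
Lemma line2_R i k : line_dom N (fun j => l i j k)
  (fun j => flip1R i j k) (fun j => flip2R i j k).
Proof.
do !apply: line_domD; try exact: line_dom_cst; last exact: line2_flip_self.
by apply: line_dom_noninc => j q le; exact: arm1_noninc.
Qed.

Lemma line3_R i j : line_dom N (l i j) (flip2R i j)
  (fun k => 1 + (arm1 i j k + arm2 i j k + arm3 i j k)).
Proof.
do !apply: line_domD; try exact: line_dom_cst; last exact: line3_flip_self.
  by apply: line_dom_noninc => k r le; exact: arm1_noninc.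
by apply: line_dom_noninc => k r le; exact: arm2_noninc.
Qed.

Lemma box_dom_R : box_dom N l (fun i j k => 1 + (i + j + k))
  (fun i j k => 1 + (arm1 i j k + arm2 i j k + arm3 i j k)).
Proof.
apply: box_dom_trans (box_dom_lines1 line1_R) _.
apply: box_dom_trans (box_dom_lines2 line2_R) _.
exact: (box_dom_lines3 l_low l_bound line3_R).
Qed.

(** Over the three compressions, [j * i] becomes [j * arm1], then [face12], which does not increase
    in [k]; [k * i] becomes [k * arm1], is kept by the second step, then becomes [face13]; [j * k]
    is first constant, then becomes [k * arm2], then [face23]. *)
Lemma box_dom_Q : box_dom N l
  (fun i j k => 1 + (i + j + k) + (j * i + k * i + j * k))
  (fun i j k => 1 + (arm1 i j k + arm2 i j k + arm3 i j k) +
                (face12 i j k + face13 i j k + face23 i j k)).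
Proof.
apply: (@box_dom_trans _ _ _ flip1Q).
  apply: box_dom_lines1 => j k; apply: line_domD; first exact: line1_R.
  apply: line_domD; last exact: line_dom_cst.
  by apply: line_domD; apply: line_domZ; exact: line1_flip.
apply: (@box_dom_trans _ _ _ flip2Q).
  apply: box_dom_lines2 => i k; apply: line_domD; first exact: line2_R.
  apply: line_domD; last first.
    move=> s sp; under eq_bigr => j do rewrite (mulnC (nat_of_ord j)).
    exact: (line_domZ k (@line2_flip_self i k) sp).
  apply: line_domD.
    move=> s sp; under eq_bigr => j do rewrite (mulnC (nat_of_ord j)).
    exact: (line2_flip_face12 i k sp).
  apply/line_domZ/line_dom_noninc => j q le; exact: arm1_noninc.
apply: (box_dom_lines3 l_low l_bound) => i j.
apply: line_domD; first exact: line3_R.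
apply: line_domD; last first.
  move=> s sp; under eq_bigr => k do rewrite (mulnC (nat_of_ord k)).
  exact: (line3_flip_face23 i j sp).
apply: line_domD.
  by apply: line_dom_noninc => k r le; exact: face12_noninc.
move=> s sp; under eq_bigr => k do rewrite (mulnC (nat_of_ord k)).
exact: (line3_flip_face13 i j sp).
Qed.

End Steps.

(** * Cardinalities and sums over a finite set as box sums *)

Lemma boxsumD N f g :
  boxsum N (fun i j k => f i j k + g i j k) = boxsum N f + boxsum N g.
Proof.
rewrite -big_split; apply: eq_bigr => i _ /=; rewrite -big_split.
by apply: eq_bigr => j _ /=; rewrite -big_split.
Qed.

Lemma eq_boxsum N f g : (forall i j k, f i j k = g i j k) ->
  boxsum N f = boxsum N g.
Proof. by move=> fg; do 3!apply: eq_bigr => ? _; rewrite fg. Qed.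

Lemma leq_boxsum N f g : (forall i j k, f i j k <= g i j k) ->
  boxsum N f <= boxsum N g.
Proof. by move=> fg; do 3!apply: leq_sum => ? _; rewrite fg. Qed.

Lemma card_fset_sub_sum (L A : {fset point}%fset) : {subset A <= L} ->
  #|` A|%fset = \sum_(y <- enum_fset L) (y \in A).
Proof.
move=> AL; rewrite card_fset_sum1 -big_mkcond -[RHS]big_filter; apply: perm_big.
apply: uniq_perm; rewrite ?filter_uniq ?fset_uniq // => x.
by rewrite mem_filter andb_idr // => /AL.
Qed.

Section FsetBox.
Variables (N : nat) (L : {fset point}%fset).
Hypothesis L_bound : forall i j k, (i, j, k) \in L -> [/\ i < N, j < N & k < N].

Lemma sum_fset_box (F : point -> nat) :
  \sum_(x <- enum_fset L) F x =
  boxsum N (fun i j k => ((i, j, k) \in L) * F (i, j, k)).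
Proof.
pose box := [seq (p, k) | p <- [seq (i, j) | i <- iota 0 N, j <- iota 0 N],
                          k <- iota 0 N].
have eqL : perm_eq (enum_fset L) [seq x <- box | x \in L].
  apply: uniq_perm; first exact: fset_uniq.
    apply/filter_uniq/allpairs_uniq; rewrite ?iota_uniq //; last first.
      by case=> ? ? [].
    by apply: allpairs_uniq; rewrite ?iota_uniq //; case=> ? ? [].
  move=> [[i j] k]; rewrite mem_filter andb_idr // => /L_bound[iN jN kN].
  by rewrite !allpairs_f ?mem_iota.
have iotaE (G : nat -> nat) : \sum_(i <- iota 0 N) G i = \sum_(i < N) G i.
  by rewrite -(big_mkord xpredT) /index_iota subn0.
rewrite (perm_big _ eqL) big_filter big_mkcond !big_allpairs iotaE.
apply: eq_bigr => i _.
rewrite iotaE; apply: eq_bigr => j _; rewrite iotaE; apply: eq_bigr => k _.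
by case: (_ \in L); rewrite ?mul1n.
Qed.

Lemma card_fset_box (A : {fset point}%fset) : {subset A <= L} ->
  #|` A|%fset = boxsum N (fun i j k => (i, j, k) \in A).
Proof.
move=> AL; rewrite (card_fset_sub_sum AL) sum_fset_box.
apply: eq_boxsum => i j k.
by have [/AL->//|] := boolP ((i, j, k) \in A); rewrite muln0.
Qed.

End FsetBox.

Lemma boxsum_factor N (a b c : nat -> nat) d :
  boxsum N (fun p q r => a p * (b q * (c r * d p q r))) =
  \sum_(p < N) a p * \sum_(q < N) b q * \sum_(r < N) c r * d p q r.
Proof.
apply: eq_bigr => p _; rewrite big_distrr; apply: eq_bigr => q _ /=.
by rewrite mulnA big_distrr /=; apply: eq_bigr => r _; rewrite !mulnA.
Qed.

Lemma sum_delta N i (f : 'I_N -> nat) (iN : i < N) :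
  \sum_(p < N) (p == i :> nat) * f p = f (Ordinal iN).
Proof.
rewrite (bigD1 (Ordinal iN)) //= eqxx mul1n big1 ?addn0 // => p.
by rewrite -val_eqE /= => /negPf->.
Qed.

Lemma sum_delta1 N i : i < N -> \sum_(p < N) (p == i :> nat) = 1.
Proof.
move=> iN; under eq_bigr => p _ do rewrite -[nat_of_bool _]muln1.
exact: (sum_delta (fun=> 1) iN).
Qed.

Lemma sum_ltn N i : i < N -> \sum_(p < N) (p < i) = i.
Proof.
move=> iN; under eq_bigr => p _ do rewrite -[nat_of_bool _]muln1.
by rewrite (sum_below (fun=> 1) (ltnW iN)) sum1_card card_ord.
Qed.

(** * Hooks and antihooks in terms of arms, faces and coordinates *)

Section HookFormulas.
Variables (N : nat) (L : {fset point}%fset).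
Hypothesis L_bound : forall i j k, (i, j, k) \in L -> [/\ i < N, j < N & k < N].
Let l i j k := (i, j, k) \in L.

Let del (i p : nat) : nat := p == i.
Let gt (i p : nat) : nat := i < p.
Let lt (i p : nat) : nat := p < i.

(** With factors [del], [gt] and [lt] this is the indicator of one piece of a hook or antihook, and
    its sum factors along the coordinates. *)
Let B (a b c : nat -> nat) p q r := a p * (b q * (c r * l p q r)).

Lemma hookR_arms i j k : l i j k ->
  hookR L (i, j, k) = 1 + (arm1 N l i j k + arm2 N l i j k + arm3 N l i j k).
Proof.
move=> lx; have [iN jN kN] := L_bound lx.
have deltaE f := (sum_delta f iN, sum_delta f jN, sum_delta f kN).
rewrite /hookR (card_fset_box L_bound) => [|x]; last first.
  by rewrite !inE /=; case: (x \in L).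
rewrite (@eq_boxsum _ _ (fun p q r =>
  B (del i) (del j) (del k) p q r + (B (gt i) (del j) (del k) p q r +
  B (del i) (gt j) (del k) p q r + B (del i) (del j) (gt k) p q r))).
  rewrite !boxsumD !boxsum_factor /del /gt !deltaE /= lx.
  congr (1 + (_ + _ + _)).
    by apply: eq_bigr => p _; rewrite !deltaE.
  by apply: eq_bigr => q _; rewrite !deltaE.
(* Trichotomy in each coordinate shows that the corner and the three open arms partition the
   hook. *)
move=> p q r; rewrite !inE /= /B /del /gt /l.
by case: (_ \in L); case: (ltngtP i p); case: (ltngtP j q); case: (ltngtP k r).
Qed.

(** Besides the corner and the arms there are three open quadrants, one in each coordinate plane
    through the corner. *)
Lemma hookQ_arms i j k : l i j k ->
  hookQ L (i, j, k) = 1 + (arm1 N l i j k + arm2 N l i j k + arm3 N l i j k) +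
    (face12 N l i j k + face13 N l i j k + face23 N l i j k).
Proof.
move=> lx; have [iN jN kN] := L_bound lx.
have deltaE f := (sum_delta f iN, sum_delta f jN, sum_delta f kN).
rewrite /hookQ (card_fset_box L_bound) => [|x]; last first.
  by rewrite !inE /=; case: (x \in L).
rewrite (@eq_boxsum _ _ (fun p q r =>
  B (del i) (del j) (del k) p q r + (B (gt i) (del j) (del k) p q r +
  B (del i) (gt j) (del k) p q r + B (del i) (del j) (gt k) p q r) +
  (B (gt i) (gt j) (del k) p q r + B (gt i) (del j) (gt k) p q r +
   B (del i) (gt j) (gt k) p q r))).
  rewrite !boxsumD !boxsum_factor /del /gt !deltaE /= lx.
  congr (1 + (_ + _ + _) + (_ + _ + _)).
  - by apply: eq_bigr => p _; rewrite !deltaE.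
  - by apply: eq_bigr => q _; rewrite !deltaE.
  - apply: eq_bigr => p _; congr (_ * _).
    by apply: eq_bigr => q _; rewrite !deltaE.
  - by apply: eq_bigr => p _; rewrite !deltaE.
move=> p q r; rewrite !inE /= /B /del /gt /l.
by case: (_ \in L); case: (ltngtP i p); case: (ltngtP j q); case: (ltngtP k r).
Qed.

Lemma boxsum_factor_le (a b c : nat -> nat) :
  boxsum N (B a b c) <=
  (\sum_(p < N) a p) * ((\sum_(q < N) b q) * \sum_(r < N) c r).
Proof.
rewrite boxsum_factor big_distrl; apply: leq_sum => p _ /=.
rewrite leq_mul2l big_distrl; apply/orP; right; apply: leq_sum => q _ /=.
rewrite leq_mul2l; apply/orP; right; apply: leq_sum => r _.
by case: (l p q r); rewrite ?muln1 ?muln0.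
Qed.

(** Each piece is bounded by its number of points, in [L] or not; antihooks enter the comparison
    through upper bounds. *)
Lemma antihookR_le i j k : l i j k -> antihookR L (i, j, k) <= 1 + (i + j + k).
Proof.
move=> lx; have [iN jN kN] := L_bound lx.
rewrite /antihookR (card_fset_box L_bound) => [|x]; last first.
  by rewrite !inE /=; case: (x \in L).
rewrite (@eq_boxsum _ _ (fun p q r =>
  B (del i) (del j) (del k) p q r + (B (lt i) (del j) (del k) p q r +
  B (del i) (lt j) (del k) p q r + B (del i) (del j) (lt k) p q r))).
  rewrite !boxsumD; do !apply: leq_add;
  apply: leq_trans (boxsum_factor_le _ _ _) _;
  by rewrite /del /lt ?sum_ltn ?sum_delta1 //; lia.
move=> p q r; rewrite !inE /= /B /del /lt /l.
by case: (_ \in L); case: (ltngtP i p); case: (ltngtP j q); case: (ltngtP k r).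
Qed.

Lemma antihookQ_le i j k : l i j k ->
  antihookQ L (i, j, k) <= 1 + (i + j + k) + (j * i + k * i + j * k).
Proof.
move=> lx; have [iN jN kN] := L_bound lx.
rewrite /antihookQ (card_fset_box L_bound) => [|x]; last first.
  by rewrite !inE /=; case: (x \in L).
rewrite (@eq_boxsum _ _ (fun p q r =>
  B (del i) (del j) (del k) p q r + (B (lt i) (del j) (del k) p q r +
  B (del i) (lt j) (del k) p q r + B (del i) (del j) (lt k) p q r) +
  (B (lt i) (lt j) (del k) p q r + B (lt i) (del j) (lt k) p q r +
   B (del i) (lt j) (lt k) p q r))).
  rewrite !boxsumD; do !apply: leq_add;
  apply: leq_trans (boxsum_factor_le _ _ _) _;
  by rewrite /del /lt ?sum_ltn ?sum_delta1 //; lia.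
move=> p q r; rewrite !inE /= /B /del /lt /l.
by case: (_ \in L); case: (ltngtP i p); case: (ltngtP j q); case: (ltngtP k r).
Qed.

End HookFormulas.

(** * From dominated selections to partial sums of sorted values *)

Definition subset_dom (X : eqType) (t : seq X) (g f : X -> nat) :=
  forall s : pred X, exists s' : pred X,
    count s' t = count s t /\
    \sum_(x <- t | s x) g x <= \sum_(x <- t | s' x) f x.

Lemma subset_dom_box N (L : {fset point}%fset) u v (g f : point -> nat) :
    (forall i j k, (i, j, k) \in L -> [/\ i < N, j < N & k < N]) ->
    box_dom N (fun i j k => (i, j, k) \in L) u v ->
    (forall i j k, (i, j, k) \in L -> g (i, j, k) <= u i j k) ->
    (forall i j k, (i, j, k) \in L -> v i j k <= f (i, j, k)) ->
  subset_dom (enum_fset L) g f.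
Proof.
move=> bnd uv gu vf s.
have [|s' [s'L c le]] := uv (fun i j k => ((i, j, k) \in L) && s (i, j, k)).
  by move=> i j k /andP[].
have cE (a : pred point) : count a (enum_fset L) =
    boxsum N (fun i j k => ((i, j, k) \in L) && a (i, j, k)).
  rewrite -sum1_count big_mkcond (sum_fset_box bnd); apply: eq_boxsum => i j k.
  by case: (_ \in L); case: (a _).
exists (fun x => s' x.1.1 x.1.2 x.2); split.
  rewrite !cE -c; apply: eq_boxsum => i j k /=.
  by rewrite andb_idl // => /s'L.
rewrite big_mkcond [leqRHS]big_mkcond !(sum_fset_box bnd) /=.
refine (leq_trans _ (leq_trans le _)); apply: leq_boxsum => i j k.
  by have [xL|//] := boolP ((i, j, k) \in L); case: (s _); rewrite ?mul1n ?gu.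
have [sx|//] := boolP (s' i j k); rewrite s'L // !mul1n; exact/vf/s'L.
Qed.

(** Sorting points instead of values records which points carry the largest values. The default 0
    covers [k] beyond the length. *)
Lemma sum_sort_take (X : eqType) (t : seq X) (f : X -> nat) k :
  \sum_(i < k) nth 0 (sort geq (map f t)) i =
  \sum_(x <- take k (sort (relpre f geq) t)) f x.
Proof.
rewrite sort_map; elim: (sort _ t) k => [|x r IH] k.
  by rewrite /= big_nil big1 // => i _; rewrite nth_nil.
case: k => [|k]; first by rewrite big_ord0 big_nil.
by rewrite big_ord_recl /= big_cons IH.
Qed.

(** Presents an initial segment as a predicate, the form that [subset_dom] accepts. *)
Lemma filter_mem_take (X : eqType) (t : seq X) k : uniq t ->
  [seq x <- t | x \in take k t] = take k t.
Proof.
rewrite -{1}(cat_take_drop k t) cat_uniq => /and3P[_ nh _].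
rewrite -[X in filter _ X](cat_take_drop k t) filter_cat.
rewrite (_ : [seq x <- take k t | _] = take k t); last exact/all_filterP/allP.
rewrite (_ : [seq x <- drop k t | _] = [::]) ?cats0 //.
by apply/eqP; rewrite -(negbK (_ == _)) -has_filter.
Qed.

(** The first [k] points in the order of [g] form a selection. Domination gives one of the same size
    whose [f]-sum is at least as large, and which cannot exceed the sum of the [k] largest values of
    [f]. *)
Lemma subset_dom_sorted (X : eqType) (t : seq X) (g f : X -> nat) k :
    uniq t -> subset_dom t g f ->
  \sum_(i < k) nth 0 (sort geq (map g t)) i <=
  \sum_(i < k) nth 0 (sort geq (map f t)) i.
Proof.
move=> t_uniq gf; case tE: t => [|x0 t'] //; rewrite -{t'}tE sum_sort_take.
set tg := sort _ t; have tg_perm : perm_eq tg t by rewrite perm_sort.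
have [s' [c le]] := gf (mem (take k tg)).
have takeE : [seq x <- tg | x \in take k tg] = take k tg.
  by apply: filter_mem_take; rewrite (perm_uniq tg_perm).
(* Only an inequality, since [k] may exceed the length of [t]. *)
have le_k : count s' t <= k.
  rewrite c -(permP tg_perm) -size_filter takeE size_take.
  by case: ltnP.
rewrite -takeE big_filter (perm_big _ tg_perm); apply: leq_trans le _.
set a := nth 0 (sort geq (map f t)).
(* Past the end [a] takes the default 0, so it is non-increasing on all naturals, as [sum_noninc_le]
   requires. *)
have a_dec m r : r <= m -> a m <= a r.
  move=> le_rm; have [lt_m|ge_m] := ltnP m (size (sort geq (map f t))).
    have geq_tr : transitive geq.
      by move=> x y z /= xy xz; exact: leq_trans xz xy.
    have srt : sorted geq (sort geq (map f t)).
      by apply: sort_sorted => x y; exact: leq_total.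
    have lt_r := leq_ltn_trans le_rm lt_m.
    exact: (sorted_leq_nth geq_tr leqnn 0 srt r m lt_r lt_m le_rm).
  by rewrite /a nth_default.
set tf := sort (relpre f geq) t.
have tf_perm : perm_eq tf t by rewrite perm_sort.
rewrite -(perm_big _ tf_perm) (big_nth x0) big_mkord big_mkcond /=.
have aE (i : 'I_(size tf)) : f (nth x0 tf i) = a i.
  by rewrite /a sort_map (nth_map x0).
rewrite (eq_bigr (fun i : 'I_(size tf) => s' (nth x0 tf i) * a i)); last first.
  by move=> i _; rewrite aE; case: (s' _); rewrite ?mul1n.
(* The list sorted by [f] is treated as one line, and the selection is compressed to its start. *)
apply: leq_trans (sum_noninc_le _ (fun i => s' (nth x0 tf i)) a_dec) _.
rewrite -(big_mkord xpredT (fun i => nat_of_bool (s' (nth x0 tf i)))).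
rewrite -(big_nth x0 xpredT (fun x => nat_of_bool (s' x))).
rewrite -big_mkcond sum1_count (permP tf_perm).
rewrite (big_ord_widen _ a le_k) [leqLHS]big_mkcond.
by apply: leq_sum => i _; case: ifP.
Qed.

(** * Equality of the totals by double counting *)

Lemma sum_hookR_antihookR L :
  \sum_(x <- enum_fset L) hookR L x = \sum_(x <- enum_fset L) antihookR L x.
Proof.
(* For cells of [L], [P x y] says that [y] is in the hook of [x], or equally that [x] is in the
   antihook of [y]; the two orders of summation give the two sides. *)
pose P (x y : point) := [|| [&& x.1.1 <= y.1.1, y.1.2 == x.1.2 & y.2 == x.2],
  [&& y.1.1 == x.1.1, x.1.2 <= y.1.2 & y.2 == x.2]
  | [&& y.1.1 == x.1.1, y.1.2 == x.1.2 & x.2 <= y.2]].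
rewrite (eq_bigr (fun x => \sum_(y <- enum_fset L) P x y)); last first.
  case=> [[i j] k] _; rewrite /hookR (@card_fset_sub_sum L) => [|y]; last first.
    by rewrite !inE /=; case: (y \in L).
  by apply: eq_big_seq => y yL; rewrite !inE /= yL -orbA.
rewrite exchange_big /=; apply: eq_bigr => -[[i j] k] _.
rewrite /antihookR (@card_fset_sub_sum L) => [|y]; last first.
  by rewrite !inE /=; case: (y \in L).
apply: eq_big_seq => y yL; rewrite !inE /= yL -orbA /P /=.
by rewrite (eq_sym i) (eq_sym j) (eq_sym k).
Qed.

Lemma sum_hookQ_antihookQ L :
  \sum_(x <- enum_fset L) hookQ L x = \sum_(x <- enum_fset L) antihookQ L x.
Proof.
pose P (x y : point) := [|| [&& x.1.1 <= y.1.1, x.1.2 <= y.1.2 & y.2 == x.2],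
  [&& x.1.1 <= y.1.1, y.1.2 == x.1.2 & x.2 <= y.2]
  | [&& y.1.1 == x.1.1, x.1.2 <= y.1.2 & x.2 <= y.2]].
rewrite (eq_bigr (fun x => \sum_(y <- enum_fset L) P x y)); last first.
  case=> [[i j] k] _; rewrite /hookQ (@card_fset_sub_sum L) => [|y]; last first.
    by rewrite !inE /=; case: (y \in L).
  by apply: eq_big_seq => y yL; rewrite !inE /= yL -orbA.
rewrite exchange_big /=; apply: eq_bigr => -[[i j] k] _.
rewrite /antihookQ (@card_fset_sub_sum L) => [|y]; last first.
  by rewrite !inE /=; case: (y \in L).
apply: eq_big_seq => y yL; rewrite !inE /= yL -orbA /P /=.
by rewrite (eq_sym i) (eq_sym j) (eq_sym k).
Qed.

(** * Transfer to multisets over an ordered field *)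

Section Cast.
Import GRing.Theory Num.Theory Order.TTheory.
Variable T : realFieldType.
Local Open Scope ring_scope.

(** The cast preserves order, so both lists are sorted permutations of the same values, and such a
    list is unique. *)
Lemma nonincreasing_seq_natr (L : {fset point}%fset) (f : point -> nat) :
  nonincreasing_seq (value_multiset T L f) =
  [seq n%:R | n <- sort geq (map f (enum_fset L))].
Proof.
apply: (@sorted_eq _ >=%R).
- by move=> x y z /= xy xz; exact: le_trans xz xy.
- by move=> x y; rewrite andbC; exact: le_anti.
- by apply: sort_sorted => x y; exact: le_total.
- rewrite sorted_map (@eq_sorted _ _ geq) => [|m n /=]; last exact: ler_nat.
  by apply: sort_sorted => m n; exact: leq_total.
rewrite perm_sort (perm_trans (perm_eq_seq_mset _)) // map_comp.
by apply: perm_map; rewrite perm_sym perm_sort.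
Qed.

Lemma majorizes_subset_dom (L : {fset point}%fset) (f g : point -> nat) :
    subset_dom (enum_fset L) g f ->
    (\sum_(x <- enum_fset L) f x = \sum_(x <- enum_fset L) g x)%N ->
  majorizes (value_multiset T L f) (value_multiset T L g).
Proof.
move=> gf eq_fg; rewrite /majorizes !nonincreasing_seq_natr.
have sumE (t : seq nat) k : \sum_(0 <= i < k) [seq n%:R | n <- t]`_i =
    (\sum_(i < k) nth 0 t i)%:R :> T.
  rewrite big_mkord natr_sum; apply: eq_bigr => i _.
  have [lt_i|ge_i] := ltnP i (size t); first by rewrite (nth_map 0%N).
  by rewrite !nth_default ?size_map.
split.
- by rewrite !size_map !size_sort !size_map.
- move=> k _; rewrite !sumE ler_nat.
  exact: subset_dom_sorted (fset_uniq _) gf.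
(* At full length the prefixes are the whole lists, and the sums are the totals. *)
rewrite !sumE !size_map !size_sort !size_map !sum_sort_take.
rewrite !take_oversize ?size_sort //.
have permE (h : point -> nat) : perm_eq (sort (relpre h geq) L) (enum_fset L).
  by rewrite perm_sort.
by rewrite (perm_big _ (permE f)) (perm_big _ (permE g)) eq_fg.
Qed.
End Cast.

(** * Enclosing the partition in a box, and the two majorizations *)

Lemma fset_point_bound (L : {fset point}%fset) :
  exists N, forall i j k, (i, j, k) \in L -> [/\ i < N, j < N & k < N].
Proof.
(* The sum of all coordinates bounds each of them; the successor makes the bound strict. *)
exists (\sum_(x <- enum_fset L) (x.1.1 + x.1.2 + x.2)).+1 => i j k xL.
have : i + j + k <= \sum_(x <- enum_fset L) (x.1.1 + x.1.2 + x.2).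
  by rewrite (big_rem (i, j, k)) //= leq_addr.
by split; lia.
Qed.

Theorem theorem5p1 (T : realFieldType) (L : {fset point}%fset)
    (hL : solid_partition L) :
  majorizes (value_multiset T L (hookR L)) (value_multiset T L (antihookR L)) /\
  majorizes (value_multiset T L (hookQ L)) (value_multiset T L (antihookQ L)).
Proof.
have [N L_bound] := fset_point_bound L.
split; apply: majorizes_subset_dom.
- apply: (subset_dom_box L_bound (box_dom_R hL L_bound)) => i j k xL.
    exact: (antihookR_le L_bound).
  by rewrite (hookR_arms L_bound).
- exact: sum_hookR_antihookR.
- apply: (subset_dom_box L_bound (box_dom_Q hL L_bound)) => i j k xL.
    exact: (antihookQ_le L_bound).
  by rewrite (hookQ_arms L_bound).
- exact: sum_hookQ_antihookQ.
Qed.
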